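(* Let $m,n\ge 1$ and let $R=(r_1,\dots,r_m)$ and $S=(s_1,\dots,s_n)$ be vectors of nonnegative integers with $r_i\le n$ for all $i$, $s_j\le m$ for all $j$, and $\sum_i r_i=\sum_j s_j$. Let $o(R)$ and $o(S)$ denote the numbers of odd components of $R$ and $S$. Then $\mathcal{A}^{+}(R,S)\neq\emptyset$ if and only if all of the following hold: (a) $R$ and $S$ are both palindromic, i.e. $r_i=r_{m+1-i}$ for all $i$ and $s_j=s_{n+1-j}$ for all $j$; (b) if $n$ is even then every component of $R$ is even, and if $n$ is odd then $s_{\lceil n/2\rceil}\ge o(R)$; if $m$ is even then every component of $S$ is even, and if $m$ is odd then $r_{\lceil m/2\rceil}\ge o(S)$; (c) if $n$ is odd then $o(R)=s_{\lceil n/2\rceil}$, and if $m$ is odd then $o(S)=r_{\lceil m/2\rceil}$; (d) $\check{S}\preceq \check{R}^*$, where $\check{R}=(\lfloor r_1/2\rfloor,\lfloor r_2/2\rfloor,\dots,\lfloor r_{\lfloor m/2\rfloor}/2\rfloor)$ and $\check{S}=(\lfloor s_1/2\rfloor,\lfloor s_2/2\rfloor,\dots,\lfloor s_{\lfloor n/2\rfloor}/2\rfloor)$.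
   Context: $\mathcal{A}^{+}(R,S)$ is the set of $m\times n$ matrices $A$ with entries in $\{0,1\}$, with $i$th row sum $r_i$ and $j$th column sum $s_j$ for all $i,j$, that are invariant under the group $D_+=\{\rho_0,\rho_\pi,r_0,r_\infty\}$, where $\rho_0$ is the identity, $(r_\infty A)_{i,j}=a_{i,\,n+1-j}$, $(r_0 A)_{i,j}=a_{m+1-i,\,j}$ and $(\rho_\pi A)_{i,j}=a_{m+1-i,\,n+1-j}$. For a nonnegative integer vector $R$, $R^*$ denotes the conjugate of (the weakly decreasing rearrangement of) $R$ viewed as an integer partition: its $k$th component is the number of $i$ with $r_i\ge k$. For nonnegative integer vectors $U,V$, $V\preceq U$ ($V$ is majorized by $U$) means that, after rearranging both in weakly decreasing order (and padding with zeros to a common length), $u_1+\dots+u_\ell\ge v_1+\dots+v_\ell$ for all $\ell$, and the total sums of $U$ and $V$ are equal. *)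

(* Defs.v *)
From mathcomp Require Import all_boot all_algebra.

Set Implicit Arguments.
Unset Strict Implicit.
Unset Printing Implicit Defensive.

Local Open Scope nat_scope.

(* Ordinals are 0-based, so the 1-based index map i |-> m + 1 - i is rev_ord;
   the entries 0, 1 of a (0,1)-matrix are false, true, and bool coerces to nat. *)
Section Symmetries.

Variables m n : nat.

Definition sym_rho0 (A : 'M[bool]_(m, n)) : 'M[bool]_(m, n) := A.

Definition sym_rhopi (A : 'M[bool]_(m, n)) : 'M[bool]_(m, n) :=
  \matrix_(i < m, j < n) A (rev_ord i) (rev_ord j).

Definition sym_r0 (A : 'M[bool]_(m, n)) : 'M[bool]_(m, n) :=
  \matrix_(i < m, j < n) A (rev_ord i) j.

Definition sym_rinf (A : 'M[bool]_(m, n)) : 'M[bool]_(m, n) :=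
  \matrix_(i < m, j < n) A i (rev_ord j).

Definition Dplus : seq ('M[bool]_(m, n) -> 'M[bool]_(m, n)) :=
  [:: sym_rho0; sym_rhopi; sym_r0; sym_rinf].

Definition Aplus (R : m.-tuple nat) (S : n.-tuple nat) :
    {set 'M[bool]_(m, n)} :=
  [set A : 'M[bool]_(m, n) |
    [&& [forall i : 'I_m, \sum_(j < n) nat_of_bool (A i j) == tnth R i],
        [forall j : 'I_n, \sum_(i < m) nat_of_bool (A i j) == tnth S j]
      & all (fun g : 'M[bool]_(m, n) -> 'M[bool]_(m, n) => g A == A) Dplus]].

End Symmetries.

Definition palindromic (k : nat) (V : k.-tuple nat) : Prop :=
  forall i : 'I_k, tnth V i = tnth V (rev_ord i).

Definition odd_components (V : seq nat) : nat := count odd V.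

(* The 1-based component of index ceil(k/2), where k is the length of V. *)
Definition middle (V : seq nat) : nat := nth 0 V (uphalf (size V)).-1.

Definition half_vector (V : seq nat) : seq nat :=
  [seq v./2 | v <- take (size V)./2 V].

(* Only the components of index 1 <= k <= max V are listed: the others are 0. *)
Definition conjugate (V : seq nat) : seq nat :=
  [seq count (fun v => k <= v) V | k <- iota 1 (\max_(v <- V) v)].

(* [majorized V U] is V \preceq U. As [take l] returns the whole sequence when l
   exceeds its size, padding with zeros is implicit. *)
Definition majorized (V U : seq nat) : Prop :=
  (forall l : nat,
     sumn (take l (sort geq V)) <= sumn (take l (sort geq U))) /\
  sumn U = sumn V.

(* Main.v *)
(* A matrix invariant under both reflections is determined by its upper left
   quarter, its middle row and its middle column. The two middle lines are
   forced by the parities of S and R, and the quarter is an arbitrary matrix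
   with row sums \check R and column sums \check S, so condition (d) is the
   Gale-Ryser theorem. The latter is proved by augmenting paths: starting from
   any matrix with the right row sums, units are moved along rows from columns
   whose sum is too large to columns whose sum is too small. *)
Require Import Defs.
From mathcomp Require Import all_boot all_algebra zify.

Local Open Scope nat_scope.

(** * Sums of the largest entries of a family *)

Lemma sumn_take_path_geq (l y : nat) (s : seq nat) :
  path geq y s -> sumn (take l s) <= sumn (take l (y :: s)).
Proof.
elim: s l y => [|z s IH] [|l] y //= /andP[zy zs].
by rewrite leq_add // (IH l z zs).
Qed.

(** Induction on [e]: when [P] rejects the head, the prefix that starts one entry later in a
    decreasing list has no larger sum. *)
Lemma sum_le_sumn_take {T : Type} (f : T -> nat) (P : pred T) (e : seq T) :
  sorted geq (map f e) ->
  \sum_(x <- e | P x) f x <= sumn (take (count P e) (map f e)).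
Proof.
elim: e => [|x e IH] /= se; first by rewrite big_nil.
have {}IH := IH (path_sorted se); rewrite big_cons.
case: (P x); first by rewrite add1n /= leq_add2l.
by rewrite add0n (leq_trans IH) // sumn_take_path_geq.
Qed.

Section SortedPrefixes.

Context {q : nat} (u : 'I_q -> nat).

(** Indices are sorted rather than values, so that a prefix of the sorted values comes from a set of
    indices. *)
Let e := sort (relpre u geq) (enum 'I_q).

Let sort_codom : sort geq [seq u j | j <- enum 'I_q] = map u e.
Proof. by rewrite sort_map. Qed.

Let perm_e : perm_eq e (enum 'I_q).
Proof. by rewrite perm_sort. Qed.

Lemma sum_set_le_sorted_prefix (J : {set 'I_q}) :
  \sum_(j in J) u j <= sumn (take #|J| (sort geq [seq u j | j <- enum 'I_q])).
Proof.
rewrite sort_codom.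
have -> : #|J| = count [in J] e.
  by rewrite (permP perm_e) cardE -size_filter enumT.
have -> : \sum_(j in J) u j = \sum_(j <- e | j \in J) u j.
  by rewrite (perm_big _ perm_e) big_enum_cond; apply: eq_bigl.
rewrite sum_le_sumn_take // -sort_codom sort_sorted // => a b.
by rewrite /geq /= leq_total.
Qed.

Lemma sorted_prefix_sum_set (l : nat) :
  exists2 J : {set 'I_q}, #|J| <= l &
    sumn (take l (sort geq [seq u j | j <- enum 'I_q])) = \sum_(j in J) u j.
Proof.
have ue : uniq (take l e) by rewrite take_uniq // (perm_uniq perm_e) enum_uniq.
exists [set j in take l e].
  by rewrite cardsE (card_uniqP ue) size_take_min geq_minl.
rewrite sort_codom -map_take sumnE big_map big_uniq //=.
by apply: eq_bigl => j; rewrite inE.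
Qed.

End SortedPrefixes.

(** * Prefix sums of the conjugate partition *)

Lemma sum_ord_ltn (l v : nat) : \sum_(j < l) (j < v) = minn l v.
Proof.
by elim: l => [|l IH]; [rewrite big_ord0 min0n | rewrite big_ord_recr /= IH; lia].
Qed.

(** Both sides count the cells in the first [l] columns of the Ferrers diagram of [V], by columns
    and by rows. *)
Lemma conjugate_prefix (l : nat) (V : seq nat) :
  sumn (take l (sort geq (conjugate V))) = \sum_(v <- V) minn l v.
Proof.
have -> : sort geq (conjugate V) = conjugate V.
  apply: sorted_sort => [a b c|]; first by rewrite /geq /=; lia.
  rewrite /conjugate sorted_map.
  apply: (sub_sorted _ (iota_sorted 1 (\max_(v <- V) v))) => a b /= ab.
  by apply: sub_count => v /=; apply: leq_trans.
rewrite /conjugate -map_take take_iota sumnE big_map.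
under eq_bigr => k _ do rewrite -sum1_count big_mkcond.
rewrite exchange_big /= big_seq [RHS]big_seq; apply: eq_bigr => v vV.
have /= := @leq_bigmax_seq _ V xpredT id v vV isT.
set M := \max_(_ <- _) _ => vM.
(* Shifting the range to start at 0 makes the bound by [v] strict; cutting the range at [M] loses
   nothing since [v <= M]. *)
rewrite (iotaDl 1 0) big_map -[minn _ _]subn0 big_mkord -[in RHS](minn_idPr vM) minnA.
exact: sum_ord_ltn.
Qed.

Lemma sumn_conjugate (V : seq nat) : sumn (conjugate V) = sumn V.
Proof.
have /perm_sumn <- : perm_eq (sort geq (conjugate V)) (conjugate V).
  by rewrite perm_sort.
rewrite -{1}(take_oversize (leqnn (size (sort geq (conjugate V))))).
rewrite conjugate_prefix size_sort size_map size_iota sumnE.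
rewrite big_seq [RHS]big_seq; apply: eq_bigr => v vV.
by apply/minn_idPr/(@leq_bigmax_seq _ V xpredT id).
Qed.

(** * Moving units within rows along a path of columns *)

Definition shiftable {p q : nat} (A : 'M[bool]_(p, q)) : rel 'I_q :=
  fun a b => [exists i, A i a && ~~ A i b].

Lemma sum_pred1 {T : finType} (c : bool) (a : T) :
  \sum_j (c && (j == a)) = c.
Proof.
rewrite (bigD1 a) //= eqxx andbT big1 ?addn0 // => j /negbTE ->.
by rewrite andbF.
Qed.

(* Moving a unit along the first edge of the path changes only the two columns
   of that edge, so the remaining edges survive because the path is simple. *)
Lemma shift_path {p q : nat} (A : 'M[bool]_(p, q)) (a : 'I_q) (s : seq 'I_q) :
  path (shiftable A) a s -> uniq (a :: s) ->
  exists A' : 'M[bool]_(p, q),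
    (forall i, \sum_j A' i j = \sum_j A i j) /\
    (forall j, \sum_i A' i j + (j == a) = \sum_i A i j + (j == last a s)).
Proof.
elim: s A a => [|x s IH] A a /=; first by move=> _ _; exists A.
rewrite inE negb_or => /andP[/existsP[i /andP[Aia Aix]] ps].
case/andP => /andP[ax nas] xs.
pose A1 : 'M[bool]_(p, q) := (\matrix_(k, j)
  (A k j && ~~ ((k == i) && (j == a)) || (k == i) && (j == x)))%R.
(* The additive form avoids truncated subtraction and can be summed over rows or columns. *)
have A1E k j : A1 k j + ((k == i) && (j == a)) = A k j + ((k == i) && (j == x)).
  rewrite mxE; case: (eqVneq k i) => [->|_] /=; last by rewrite andbT orbF.
  case: (eqVneq j a) => [->|_]; first by rewrite Aia (negbTE ax).
  by case: (eqVneq j x) => [->|_]; rewrite ?(negbTE Aix) //= andbT orbF.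
have A1col k j : j != a -> j != x -> A1 k j = A k j.
  by move=> /negbTE ja /negbTE jx; rewrite mxE ja jx !andbF andbT orbF.
have ps1 : path (shiftable A1) x s.
  (* Column [x] only gains a unit, so the edge leaving [x] survives; the later edges avoid both [a]
     and [x]. *)
  case: s ps nas xs {IH} => //= y s /andP[/existsP[k /andP[Akx Aky]] ys].
  rewrite inE negb_or => /andP[ay nas] /andP[].
  rewrite inE negb_or => /andP[xy nxs] _; apply/andP; split.
    apply/existsP; exists k; rewrite (A1col k y) 1?eq_sym // Aky andbT mxE Akx.
    by rewrite [x == a]eq_sym (negbTE ax) andbF.
  rewrite -(@eq_in_path _ [in y :: s] (shiftable A)) //.
    move=> b c bs cs; apply: eq_existsb => l.
    have ne d : d \in y :: s -> d != a /\ d != x.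
      rewrite inE => /orP[/eqP->|ds]; first by rewrite ![y == _]eq_sym.
      by split; [apply: contraNneq nas | apply: contraNneq nxs] => <-.
    by have [? ?] := ne _ bs; have [? ?] := ne _ cs; rewrite !A1col.
have [A' [rA' cA']] := IH A1 x ps1 xs; exists A'; split=> [k|j].
  have : \sum_j (A1 k j + ((k == i) && (j == a))) =
         \sum_j (A k j + ((k == i) && (j == x))) by apply: eq_bigr.
  by rewrite rA' !big_split /= !sum_pred1 => /addIn.
have : \sum_k (A1 k j + ((j == a) && (k == i))) =
       \sum_k (A k j + ((j == x) && (k == i))).
  by apply: eq_bigr => k _; rewrite andbC A1E andbC.
rewrite !big_split /= !sum_pred1 => cA1; apply: (@addIn (j == x)).
by rewrite addnAC cA' addnAC cA1 addnAC.
Qed.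

(** * The Gale-Ryser theorem *)

Lemma exists_matrix_of_row_sums {p q : nat} (v : 'I_p -> nat) :
  (forall i, v i <= q) ->
  exists A : 'M[bool]_(p, q), forall i, \sum_j A i j = v i.
Proof.
move=> vq; exists (\matrix_(i, j) (j < v i)%N)%R => i.
under eq_bigr do rewrite mxE.
by rewrite sum_ord_ltn; apply/minn_idPr.
Qed.

Lemma sum_columns_row_le {q : nat} (B : 'I_q -> bool) (J : {set 'I_q}) :
  \sum_(j in J) B j <= minn #|J| (\sum_j B j).
Proof.
rewrite leq_min -sum1_card leq_sum /=; last by move=> j _; case: (B j).
by rewrite [leqRHS](bigID [in J]) leq_addr.
Qed.

Section GaleRyser.

Context {p q : nat} (v : 'I_p -> nat) (u : 'I_q -> nat).

(* If no column in deficit is reachable from a column in excess, let [Y] be the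
   set of unreachable columns: every row meeting the complement of [Y] is full
   on [Y], so [Y] violates the hypothesis on [u]. *)
Lemma matrix_of_column_sums (A : 'M[bool]_(p, q)) :
    (forall i, \sum_j A i j = v i) -> \sum_j u j = \sum_i v i ->
    (forall J : {set 'I_q}, \sum_(j in J) u j <= \sum_i minn #|J| (v i)) ->
  exists A' : 'M[bool]_(p, q),
    (forall i, \sum_j A' i j = v i) /\ (forall j, \sum_i A' i j = u j).
Proof.
move=> rA uv H.
(* Induction on the total excess: truncated subtraction ignores the columns in deficit. *)
have [d] := ubnP (\sum_j (\sum_i A i j - u j)).
elim: d A rA => // d IH A rA; rewrite ltnS => Dd.
set w := fun j => \sum_i A i j.
have wv : \sum_j w j = \sum_i v i.
  by rewrite exchange_big; apply: eq_bigr => i _; rewrite rA.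
pose X := [set y | [exists a, (u a < w a) && connect (shiftable A) a y]].
case: (pickP [pred b in X | w b < u b]) => [b /andP[]|noX].
  rewrite inE => /existsP[a /andP[ua /connectP[s ps bE]]] wb.
  case/shortenP: ps bE => s' ps' us' _ bE.
  have [A' [rA' cA']] := shift_path _ _ _ ps' us'.
  have ab : a != b by apply: contraTneq ua => ->; rewrite -leqNgt ltnW.
  rewrite -bE in cA'; apply: (IH A') => [i|]; first by rewrite rA' rA.
  (* The excess drops by one at [a]; the unit gained by [b] creates none, because [b] was in
     deficit. *)
  apply: leq_trans Dd; rewrite -addn1 -[X in _ + X](sum_pred1 true a) -big_split /=.
  apply: leq_sum => j _; have := cA' j; rewrite -/(w j).
  case: (eqVneq j b) => [->|_]; last by case: (eqVneq j a) => [->|_] /=; lia.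
  by rewrite eq_sym (negbTE ab) /=; lia.
have sumX F : \sum_j F j = \sum_(j in X) F j + \sum_(j in ~: X) F j.
  by rewrite (bigID [in X]) /=; congr (_ + _); apply: eq_bigl => j; rewrite in_setC.
have Xu j : j \in X -> u j <= w j.
  by move=> jX; have := noX j; rewrite /= jX /= => /negbT; rewrite -leqNgt.
have Ysum : \sum_(j in ~: X) u j <= \sum_(j in ~: X) w j.
  apply: leq_trans (H _) _; rewrite exchange_big /=; apply: leq_sum => i _.
  (* A row with a unit in [X] is full on the complement of [X]; any other row has all its [v i]
     units there. Either count is at least the minimum. *)
  case: (pickP [pred x in X | A i x]) => [x /andP[/= xX Aix]|noA].
    rewrite geq_min -sum1_card leq_sum // => y; rewrite inE => yX.
    rewrite lt0b; apply: contraNT yX => Aiy.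
    move: xX; rewrite !inE => /existsP[a /andP[ua ax]].
    apply/existsP; exists a; rewrite ua (connect_trans ax) // connect1 //.
    by apply/existsP; exists i; rewrite Aix.
  rewrite geq_min -rA sumX [X in X + _]big1 ?leqnn ?orbT // => j jX.
  by have := noA j; rewrite /= jX /= => ->.
have Xsum : \sum_(j in X) w j <= \sum_(j in X) u j.
  by have := uv; rewrite -wv !sumX; lia.
(* No column of [X] is in deficit, so one in excess would make the sum of [w] over [X] too large.
   Equality of the totals then rules out deficits everywhere. *)
have wu j : w j <= u j.
  rewrite leqNgt; apply/negP => uj.
  have jX : j \in X by rewrite inE; apply/existsP; exists j; rewrite uj connect0.
  suff : \sum_(j in X) u j < \sum_(j in X) w j by rewrite ltnNge Xsum.
  rewrite (bigD1 j) // [ltnRHS](bigD1 j) //= -addSn leq_add // leq_sum //.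
  by move=> k /andP[/Xu].
exists A; split=> // j; apply/eqP; rewrite eqn_leq wu /= leqNgt; apply/negP => wj.
suff : \sum_j w j < \sum_j u j by rewrite uv wv ltnn.
rewrite (bigD1 j) // [ltnRHS](bigD1 j) //= -addSn leq_add // leq_sum //.
Qed.

Theorem gale_ryser :
  (exists A : 'M[bool]_(p, q),
    (forall i, \sum_j A i j = v i) /\ (forall j, \sum_i A i j = u j)) <->
  majorized [seq u j | j <- enum 'I_q] (conjugate [seq v i | i <- enum 'I_p]).
Proof.
have sumu : sumn [seq u j | j <- enum 'I_q] = \sum_j u j.
  by rewrite sumnE big_map big_enum.
have sumv : sumn [seq v i | i <- enum 'I_p] = \sum_i v i.
  by rewrite sumnE big_map big_enum.
have prefix l :
    sumn (take l (sort geq (conjugate [seq v i | i <- enum 'I_p]))) =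
    \sum_i minn l (v i).
  by rewrite conjugate_prefix big_map big_enum.
split=> [[A [rA cA]]|[H uv]].
  split=> [l|].
    rewrite prefix; have [J Jl ->] := sorted_prefix_sum_set u l.
    under eq_bigr do rewrite -cA.
    rewrite exchange_big /=; apply: leq_sum => i _; rewrite -rA.
    apply: leq_trans (sum_columns_row_le _ _) _.
    by rewrite leq_min geq_minr geq_min Jl.
  rewrite sumn_conjugate sumu sumv.
  under eq_bigr do rewrite -rA; under [RHS]eq_bigr do rewrite -cA.
  exact: exchange_big.
rewrite sumn_conjugate sumu sumv in uv.
have {}H (J : {set 'I_q}) : \sum_(j in J) u j <= \sum_i minn #|J| (v i).
  by rewrite -prefix (leq_trans (sum_set_le_sorted_prefix _ _)).
(* For [J] the set of all columns, a row with [v i > q] would make the truncated sum smaller than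
   the total. *)
have vq i : v i <= q.
  have := H setT; rewrite cardsT card_ord.
  under eq_bigl do rewrite inE; rewrite -uv.
  rewrite leqNgt => /negP h; rewrite leqNgt; apply/negP => qv; apply: h.
  rewrite (bigD1 i) // [ltnRHS](bigD1 i) //= -addSn leq_add ?leq_sum //.
    by rewrite gtn_min qv.
  by move=> k _; apply: geq_minr.
have [A rA] := exists_matrix_of_row_sums v vq.
exact: matrix_of_column_sums A rA _ H.
Qed.

End GaleRyser.

(** * Palindromic sums and folding of indices *)

Lemma sum_palindrome (k : nat) (F : nat -> nat) :
    (forall i, i < k -> F (k - i.+1) = F i) ->
  \sum_(i < k) F i = (\sum_(i < k./2) F i).*2 + odd k * F k./2.
Proof.
elim/ltn_ind: k F => -[|[|k]] IH F Fk; first by rewrite !big_ord0.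
  by rewrite big_ord_recl !big_ord0 /=; lia.
rewrite big_ord_recl big_ord_recr /= [in RHS]big_ord_recl /=.
rewrite -(Fk 0) // subn1 /= negbK.
have /= IHk := IH k (ltnW (ltnSn _)) (fun i => F i.+1).
rewrite IHk => [|i ik]; last by rewrite -[RHS]Fk; [congr F; lia | lia].
rewrite -[bump 0 k]/k.+1.
by rewrite -[\sum_(i < _) F (bump 0 i)]/(\sum_(i < k./2) F i.+1); lia.
Qed.

(** The representative in the first half of the orbit of [i] under reversal; for odd [k] the middle
    index [k./2] is its own orbit. *)
Definition fold_index (k i : nat) : nat := minn i (k - i.+1).

Lemma fold_index_sym (k i : nat) :
  i < k -> fold_index k (k - i.+1) = fold_index k i.
Proof. rewrite /fold_index; lia. Qed.

Lemma fold_indexP (k i : nat) :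
  i < k -> fold_index k i < k./2 \/ odd k /\ fold_index k i = k./2.
Proof. rewrite /fold_index; lia. Qed.

Lemma sum_fold_index (k : nat) (F : nat -> nat) :
  \sum_(i < k) F (fold_index k i) = (\sum_(i < k./2) F i).*2 + odd k * F k./2.
Proof.
rewrite (@sum_palindrome k (fun i => F (fold_index k i))); last first.
  by move=> i ik; rewrite fold_index_sym.
congr (_.*2 + _).
  by apply: eq_bigr => i _; congr F; rewrite /fold_index; have := ltn_ord i; lia.
by case: (boolP (odd k)) => // ok; congr (_ * F _); rewrite /fold_index; lia.
Qed.

Lemma palindromic_nth {k : nat} (V : k.-tuple nat) :
  palindromic V <-> forall i, i < k -> nth 0 V (k - i.+1) = nth 0 V i.
Proof.
split=> [pV i ik | pV i]; last by rewrite !(tnth_nth 0) pV.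
by have := pV (Ordinal ik); rewrite !(tnth_nth 0) /= => ->.
Qed.

Lemma palindromic_fold {k : nat} (V : k.-tuple nat) (i : nat) :
  palindromic V -> i < k -> nth 0 V (fold_index k i) = nth 0 V i.
Proof.
move=> /palindromic_nth pV ik; rewrite /fold_index /minn.
by case: ifP => // _; apply: pV.
Qed.

Lemma odd_componentsE {k : nat} (V : k.-tuple nat) :
  odd_components V = \sum_(i < k) odd (nth 0 V i).
Proof.
rewrite /odd_components -sum1_count big_mkcond (big_nth 0) big_mkord size_tuple.
by apply: eq_bigr.
Qed.

Lemma middleE {k : nat} (V : k.-tuple nat) :
  odd k -> middle V = nth 0 V k./2.
Proof. by move=> ok; rewrite /middle size_tuple; congr nth; lia. Qed.

Lemma half_vectorE {k : nat} (V : k.-tuple nat) :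
  half_vector V = [seq (nth 0 V i)./2 | i : 'I_k./2 <- enum 'I_k./2].
Proof.
rewrite /half_vector -(map_nth_iota0 0); last by rewrite size_tuple; lia.
by rewrite size_tuple -val_enum_ord -!map_comp.
Qed.

(** * Folding and unfolding symmetric matrices *)

Lemma Aplus_neq0P {m n : nat} (R : m.+1.-tuple nat) (S : n.+1.-tuple nat) :
  Aplus R S != set0 <-> exists a : nat -> nat -> bool,
    [/\ forall i, i < m.+1 -> \sum_(j < n.+1) a i j = nth 0 R i,
        forall j, j < n.+1 -> \sum_(i < m.+1) a i j = nth 0 S j,
        forall i j, i < m.+1 -> j < n.+1 -> a (m.+1 - i.+1) j = a i j
      & forall i j, i < m.+1 -> j < n.+1 -> a i (n.+1 - j.+1) = a i j].
Proof.
split=> [/set0Pn[A]|[a [rA cA sm sn]]].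
  rewrite inE => /and3P[/forallP rA /forallP cA].
  case/and5P => _ _ /eqP/matrixP s0 /eqP/matrixP soo _.
  have inord_rev k i : i < k.+1 -> inord (k.+1 - i.+1) = rev_ord (inord i) :> 'I_k.+1.
    by move=> ik; apply: val_inj; rewrite /= !inordK // subSS ltnS leq_subr.
  exists (fun i j => A (inord i) (inord j)); split=> [i im|j jn|i j im _|i j _ jn].
  - under eq_bigr do rewrite inord_val.
    by rewrite (eqP (rA _)) (tnth_nth 0) inordK.
  - under eq_bigr do rewrite inord_val.
    by rewrite (eqP (cA _)) (tnth_nth 0) inordK.
  - by rewrite inord_rev // -[in RHS]s0 mxE.
  - by rewrite inord_rev // -[in RHS]soo mxE.
apply/set0Pn; exists (\matrix_(i, j) a i j)%R; rewrite inE; apply/and3P; split.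
- apply/forallP => i; under eq_bigr do rewrite mxE.
  by rewrite rA // (tnth_nth 0).
- apply/forallP => j; under eq_bigr do rewrite mxE.
  by rewrite cA // (tnth_nth 0).
apply/and5P; split=> //; apply/eqP/matrixP => i j; rewrite !mxE ?sm ?sn //=.
by rewrite subSS ltnS leq_subr.
Qed.

(** Columns pair off under reversal, so a row sum is even except for its middle entry: the middle
    column records the parities of [R]. Transposing gives the same facts for [S]. *)
Lemma symmetric_row_sums {m n : nat} (R : m.-tuple nat) (S : n.-tuple nat)
    (a : nat -> nat -> bool) :
    (forall i, i < m -> \sum_(j < n) a i j = nth 0 R i) ->
    (forall j, j < n -> \sum_(i < m) a i j = nth 0 S j) ->
    (forall i j, i < m -> j < n -> a (m - i.+1) j = a i j) ->
    (forall i j, i < m -> j < n -> a i (n - j.+1) = a i j) ->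
  [/\ palindromic R, ~~ odd n -> forall i, ~~ odd (tnth R i),
      odd n -> odd_components R = middle S
    & forall i, i < m -> \sum_(j < n./2) a i j = (nth 0 R i)./2].
Proof.
move=> rA cA sm sn.
have rowE i : i < m ->
    nth 0 R i = (\sum_(j < n./2) a i j).*2 + odd n * a i n./2.
  move=> im; rewrite -rA // (@sum_palindrome n (fun j => a i j)) // => j jn.
  by rewrite sn.
have row_odd i : i < m -> odd (nth 0 R i) = odd n && a i n./2.
  by move=> /rowE->; case: (odd n) (a i _) => -[]; rewrite oddD odd_double.
split.
- apply/palindromic_nth => i im; rewrite -!rA //; last lia.
  by apply: eq_bigr => j _; rewrite sm.
- by move=> en i; rewrite (tnth_nth 0) row_odd // (negbTE en).
- move=> on; rewrite odd_componentsE middleE // -cA; last lia.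
  by apply: eq_bigr => i _; rewrite row_odd // on.
- by move=> i /rowE->; case: (odd n) (a i n./2) => -[] /=; lia.
Qed.

(** Here [c] holds the quarter, bordered by the middle column at index [n./2] and the middle row at
    index [m./2]. *)
Lemma unfolded_row_sums {m n : nat} (R : m.-tuple nat) (S : n.-tuple nat)
    (c : nat -> nat -> bool) :
    palindromic R -> palindromic S ->
    (~~ odd n -> forall i, ~~ odd (tnth R i)) ->
    (odd m -> odd_components S = middle R) ->
    (forall i, i < m./2 -> \sum_(j < n./2) c i j = (nth 0 R i)./2) ->
    (forall i, i < m./2 -> c i n./2 = odd (nth 0 R i)) ->
    (forall j, j < n./2 -> c m./2 j = odd (nth 0 S j)) ->
    (odd m -> odd n -> c m./2 n./2 = odd (nth 0 S n./2)) ->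
  forall i, i < m ->
    \sum_(j < n) c (fold_index m i) (fold_index n j) = nth 0 R i.
Proof.
move=> pR /palindromic_nth pS evR oS cB cR cS cRS i im.
rewrite (sum_fold_index n (fun j => c (fold_index m i) j)).
rewrite -(palindromic_fold R i) //.
have [fi|[om ->]] := fold_indexP m i im.
  rewrite cB // cR //; case: (boolP (odd n)) => [_|/evR ev].
    by rewrite mul1n addnC odd_double_half.
  have fm : fold_index m i < m by lia.
  have := ev (Ordinal fm); rewrite (tnth_nth 0) /=.
  by rewrite -[in RHS](odd_double_half (nth 0 R _)) => /negbTE->; rewrite addn0.
(* The middle row unfolds to the parities of [S], whose sum is the number of odd components. *)
rewrite -middleE // -oS // odd_componentsE.
rewrite (sum_palindrome n (fun j => odd (nth 0 S j))); last first.
  by move=> j jn; rewrite pS.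
congr (_.*2 + _); first by apply: eq_bigr => j _; rewrite cS.
by case: (boolP (odd n)) => // on; rewrite cRS.
Qed.

Theorem theorem14 (m n : nat) (R : m.-tuple nat) (S : n.-tuple nat)
    (hm : 1 <= m) (hn : 1 <= n)
    (hR : forall i : 'I_m, tnth R i <= n)
    (hS : forall j : 'I_n, tnth S j <= m)
    (hRS : \sum_(i < m) tnth R i = \sum_(j < n) tnth S j) :
  Aplus R S != set0 <->
  [/\ palindromic R /\ palindromic S,
      ((~~ odd n -> forall i : 'I_m, ~~ odd (tnth R i)) /\
       (odd n -> odd_components R <= middle S)) /\
      ((~~ odd m -> forall j : 'I_n, ~~ odd (tnth S j)) /\
       (odd m -> odd_components S <= middle R)),
      (odd n -> odd_components R = middle S) /\
      (odd m -> odd_components S = middle R)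
    & majorized (half_vector S) (conjugate (half_vector R))].
Proof.
case: m n R S hm hn {hR hS hRS} => [|m] [|n] // R S _ _.
rewrite Aplus_neq0P; split.
  case=> a [rA cA sm sn].
  have [pR evR oR hR] := symmetric_row_sums R S a rA cA sm sn.
  have [pS evS oS hS] := symmetric_row_sums S R (fun j i => a i j) cA rA
    (fun j i jn im => sn i j im jn) (fun j i jn im => sm i j im jn).
  split=> //; first by split; split=> // o; rewrite ?oR ?oS.
  rewrite !half_vectorE; apply/gale_ryser.
  exists (\matrix_(i, j) a i j)%R; split=> [i|j].
    by under eq_bigr do rewrite mxE; rewrite hR //; have := ltn_ord i; lia.
  by under eq_bigr do rewrite mxE; rewrite hS //; have := ltn_ord j; lia.
case=> -[pR pS] [[evR _] [evS _]] [oR oS].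
rewrite !half_vectorE => /gale_ryser[B [rB cB]].
set p := m.+1./2 in B rB cB; set q := n.+1./2 in B rB cB.
(* Extends [B] to natural numbers; the default [false] is never read by [c]. *)
pose b i j :=
  if insub i is Some k then if insub j is Some l then B k l else false else false.
have bE (k : 'I_p) (l : 'I_q) : b k l = B k l by rewrite /b !valK.
pose c i j :=
  if i < p then if j < q then b i j else odd (nth 0 R i)
  else if j < q then odd (nth 0 S j) else odd (nth 0 R p).
(* The corner lies on both middle lines. Off the middle, odd components of [R] come in pairs, so
   their number, which is the middle component of [S], has the parity of the middle component of
   [R]. *)
have corner : odd m.+1 -> odd n.+1 -> odd (nth 0 R p) = odd (nth 0 S q).
  move=> om on; rewrite -(middleE S) // -oR // odd_componentsE.
  rewrite (sum_palindrome m.+1 (fun i => odd (nth 0 R i))) ?om.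
    by rewrite oddD odd_double mul1n; case: (odd _).
  by move=> i im; have /palindromic_nth-> := pR.
exists (fun i j => c (fold_index m.+1 i) (fold_index n.+1 j)).
split=> [||i j im jn|i j im jn]; try by rewrite fold_index_sym.
- apply: (unfolded_row_sums R S c) => // [i ip|i ip|j jq|om on].
  + rewrite -(rB (Ordinal ip)); apply: eq_bigr => j _.
    by rewrite /c ip ltn_ord -bE.
  + by rewrite /c ip ltnn.
  + by rewrite /c ltnn jq.
  + by rewrite /c !ltnn corner.
- apply: (unfolded_row_sums S R (fun j i => c i j)) => // [j jq|j jq|i ip|_ _].
  + rewrite -(cB (Ordinal jq)); apply: eq_bigr => i _.
    by rewrite /c jq ltn_ord -bE.
  + by rewrite /c jq ltnn.
  + by rewrite /c ltnn ip.
  + by rewrite /c !ltnn.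
Qed.
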